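(* Let $K_i\in\mathcal{K}^2$, $i\in[3]$, be such that $K_i\subset\mathbb{B}^2_2$ with $\mathrm{R}(K_i)=1$, for $i\in[3]$. Then $$\mathrm{R}(K_1+K_2+K_3)\ \ge\ 2.$$ Moreover, equality holds only if, after a suitable common rotation, $K_i$ contains the segment $$\left[(\cos(i\pi/3),\sin(i\pi/3)),\,-(\cos(i\pi/3),\sin(i\pi/3))\right],\qquad i\in[3].$$
   Context: $[3]:=\{1,2,3\}$. $\mathcal{K}^2$ denotes the set of all $2$-dimensional convex bodies, i.e., convex and compact sets, in $\mathbb{R}^2$. $\mathbb{B}^2_2=\{x\in\mathbb{R}^2:\|x\|_2\le 1\}$ is the Euclidean unit disc, where $\|\cdot\|_2$ is the Euclidean norm. $\mathrm{R}(K)$ is the Euclidean circumradius of $K$, i.e., the smallest $\lambda\ge 0$ such that $K\subset x+\lambda\mathbb{B}^2_2$ for some $x\in\mathbb{R}^2$. Sums of sets are Minkowski (vector) sums, and $[x,y]$ is the line segment joining $x$ and $y$. A common rotation means one rotation of $\mathbb{R}^2$ about the origin applied to all three sets.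
   Formalization: The equality case is stated up to renumbering K_1, K_2, K_3: after a common rotation the bodies contain the three segments in some order; with fixed labels it fails for diameters at angles 2π/3, π/3, π. *)

(* Defs.v *)
From HB Require Import structures.
From mathcomp Require Import all_boot all_order all_algebra all_fingroup.
From mathcomp Require Import all_classical all_reals all_analysis.
From mathcomp Require Import lra.

Set Implicit Arguments.
Unset Strict Implicit.
Unset Printing Implicit Defensive.

Import Order.TTheory GRing.Theory Num.Theory.
Import numFieldNormedType.Exports.

Local Open Scope classical_set_scope.
Local Open Scope ring_scope.

(* The plane is 'rV[R]_2. Its library norm `|x| is the maximum norm, which
   induces the usual topology but is not the Euclidean norm. *)
Definition euclidean_norm (R : realType) (x : 'rV[R]_2) : R :=
  Num.sqrt (\sum_(j < 2) x 0 j ^+ 2).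

Definition unit_disc (R : realType) : set 'rV[R]_2 :=
  [set x | euclidean_norm x <= 1].

Definition convex_body (R : realType) (K : set 'rV[R]_2) : Prop :=
  @convex_set R 'rV[R]_2 K /\ compact K.

Definition minkowski_sum (R : realType) (A B : set 'rV[R]_2) : set 'rV[R]_2 :=
  [set a + b | a in A & b in B].

Definition circumscribing_radii (R : realType) (K : set 'rV[R]_2) : set R :=
  [set l | 0 <= l /\
     exists x, K `<=` [set x + l *: b | b in @unit_disc R]].

(* For a compact K this infimum is a minimum: see circumradius_min below. *)
Definition circumradius (R : realType) (K : set 'rV[R]_2) : R :=
  inf (circumscribing_radii K).

Definition segment (R : realType) (x y : 'rV[R]_2) : set 'rV[R]_2 :=
  [set (1 - t) *: x + t *: y | t in `[0, 1]].

Definition vec2 (R : realType) (a b : R) : 'rV[R]_2 :=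
  \row_j if j == 0 then a else b.

Definition direction (R : realType) (t : R) : 'rV[R]_2 := vec2 (cos t) (sin t).

Definition rotation (R : realType) (t : R) (x : 'rV[R]_2) : 'rV[R]_2 :=
  vec2 (cos t * x 0 0 - sin t * x 0 1) (sin t * x 0 0 + cos t * x 0 1).

Section circumradius_min.
Context {R : realType}.
Implicit Types (K : set 'rV[R]_2) (x y : 'rV[R]_2).

Lemma euclidean_normZ (a : R) x :
  euclidean_norm (a *: x) = `|a| * euclidean_norm x.
Proof.
rewrite /euclidean_norm -sqrtr_sqr -sqrtrM ?sqr_ge0// mulr_sumr.
by congr Num.sqrt; apply: eq_bigr => j _; rewrite mxE exprMn.
Qed.

Lemma coord_le_euclidean_norm x j : `|x 0 j| <= euclidean_norm x.
Proof.
rewrite -sqrtr_sqr ler_sqrt; last by apply: sumr_ge0 => i _; exact: sqr_ge0.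
by rewrite (bigD1 j)//= lerDl sumr_ge0// => i _; exact: sqr_ge0.
Qed.

Lemma euclidean_norm_eq0 x : euclidean_norm x <= 0 -> x = 0.
Proof.
move=> x0; apply/rowP => j; rewrite mxE; apply/eqP.
by rewrite -normr_le0 (le_trans (coord_le_euclidean_norm x j)).
Qed.

Lemma continuous_euclidean_norm : continuous (@euclidean_norm R).
Proof.
have sumE : (fun x : 'rV[R]_2 => \sum_(j < 2) x 0 j ^+ 2) =
            (fun x => x 0 0 * x 0 0 + x 0 1 * x 0 1).
  apply/funext => y; rewrite big_ord_recl big_ord_recl big_ord0 addr0 !expr2.
  by rewrite (_ : lift _ _ = 1)//; exact/val_inj.
have sum_cont : continuous (fun x : 'rV[R]_2 => \sum_(j < 2) x 0 j ^+ 2).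
  rewrite sumE => x; have cc j := @coord_continuous R 1 2 0 j x.
  exact: (cvgD (cvgM (cc 0) (cc 0)) (cvgM (cc 1) (cc 1))).
move=> x; exact: (continuous_comp (sum_cont x) (@sqrt_continuous R _)).
Qed.

Lemma disc_scaleE x (l : R) : 0 <= l ->
  [set x + l *: b | b in @unit_disc R] = [set y | euclidean_norm (y - x) <= l].
Proof.
move=> l0; apply/seteqP; split => y /=.
  move=> [b b1 <-]; rewrite addrAC subrr add0r euclidean_normZ ger0_norm//.
  by rewrite ler_piMr.
move=> yx; have [l00|l00] := eqVneq l 0.
  exists 0; last first.
    rewrite l00 scale0r addr0; apply/esym/eqP; rewrite -subr_eq0.
    by apply/eqP/euclidean_norm_eq0; rewrite -l00.
  by rewrite /unit_disc/= -(scale0r (0 : 'rV[R]_2)) euclidean_normZ normr0 mul0r.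
exists (l^-1 *: (y - x)); last by rewrite scalerA divff// scale1r addrC subrK.
rewrite /unit_disc /= euclidean_normZ ger0_norm ?invr_ge0//.
by rewrite mulrC ler_pdivrMr ?mul1r// lt_neqAle eq_sym l00.
Qed.

Lemma circumradius_min K : compact K ->
  circumscribing_radii K (circumradius K) /\
  lbound (circumscribing_radii K) (circumradius K).
Proof.
move=> cK; have lb0 : lbound (circumscribing_radii K) 0 by move=> l [].
suff [m Km mlb] : exists2 m, circumscribing_radii K m &
    lbound (circumscribing_radii K) m.
  suff -> : circumradius K = m by [].
  apply/eqP; rewrite eq_le lb_le_inf ?andbT//; last by exists m.
  by apply: ge_inf => //; exists 0.
have [->|/set0P[k0 Kk0]] := eqVneq K set0;
  first by exists 0; [split => //; exists 0|move=> l []].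
have norm_sub_cont : continuous (fun z : 'rV[R]_2 => euclidean_norm (z - 0)).
  by move=> z; under eq_fun do rewrite subr0; exact: continuous_euclidean_norm.
have [c _ cmax] := compact_EVT_max (ex_intro K k0 Kk0) cK
  (continuous_subspaceT norm_sub_cont).
pose L := euclidean_norm (c - 0).
have L0 : 0 <= L by exact: sqrtr_ge0.
pose box := [set v : 'rV[R]_2 | forall i, `[k0 0 i - L, k0 0 i + L]%classic (v 0 i)].
have cbox : compact box.
  by apply: (@rV_compact _ _ (fun i => `[k0 0 i - L, k0 0 i + L]%classic)) => i;
    exact: segment_compact.
pose G := [set p : 'rV[R]_2 * R |
  forall k, K k -> 0 <= p.2 - euclidean_norm (k - p.1)].
have clG : closed G.
  have -> : G = \bigcap_(k in K)
      ((fun p : 'rV[R]_2 * R => p.2 - euclidean_norm (k - p.1)) @^-1` [set r | 0 <= r]).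
    by apply/seteqP; split => p Gp k /Gp.
  apply: closed_bigI => k _; apply: preimage_closed; last exact: closed_ge.
  move=> p _; apply: cvgB; first exact: cvg_snd.
  have kp : {for p, continuous (fun q : 'rV[R]_2 * R => k - q.1)}.
    by apply: cvgB; [exact: cvg_cst|exact: cvg_fst].
  exact: (continuous_comp kp (@continuous_euclidean_norm (k - p.1))).
have cGb : compact ((box `*` `[0, L]%classic) `&` G).
  by apply: compact_closedI => //; apply: compact_setX => //; exact: segment_compact.
have inbox x l : l <= L -> (forall k, K k -> euclidean_norm (k - x) <= l) -> box x.
  move=> lL /(_ _ Kk0) xl i; rewrite /= in_itv/=.
  have := le_trans (coord_le_euclidean_norm _ i) (le_trans xl lL).
  by rewrite !mxE ler_norml => /andP[? ?]; apply/andP; split; lra.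
have KL k : K k -> euclidean_norm (k - 0) <= L.
  by move=> Kk; apply: cmax; rewrite inE.
have Gne : ((box `*` `[0, L]%classic) `&` G) !=set0.
  exists (0, L); split; last by move=> k Kk /=; rewrite subr_ge0 KL.
  by split => /=; [exact: inbox KL|rewrite in_itv/= L0 lexx].
have [[x m] /[!inE]-[[/= _ /[!in_itv]/= /andP[m0 mL]] Gxm] mmin] :=
  compact_EVT_min Gne cGb
    (continuous_subspaceT (fun p => @cvg_snd _ _ (nbhs p.1) (nbhs p.2) _)).
exists m.
  split => //; exists x; rewrite disc_scaleE// => k Kk /=.
  by rewrite -subr_ge0 (Gxm k).
move=> l [l0 [y]]; rewrite disc_scaleE// => Kyl.
have [lL|/ltW] := leP l L; last exact: le_trans.
apply: (mmin (y, l)); rewrite inE; split; last first.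
  by move=> k /Kyl; rewrite /= subr_ge0.
by split => /=; [exact: inbox Kyl|rewrite in_itv/= l0 lL].
Qed.

End circumradius_min.

(* Main.v *)
Require Import Defs.
From mathcomp Require Import all_boot all_order all_algebra all_fingroup.
From mathcomp Require Import all_classical all_reals all_analysis.
From mathcomp Require Import ring lra.

Set Implicit Arguments.
Unset Strict Implicit.
Unset Printing Implicit Defensive.

Import Order.TTheory GRing.Theory Num.Theory.
Import numFieldNormedType.Exports.

Local Open Scope classical_set_scope.
Local Open Scope ring_scope.

(* Since R(K_i) = 1 and K_i lies in the unit disc, K_i contains the vertices of
   a (possibly degenerate) triangle inscribed in the unit circle whose angles
   a, b, c lie in [0, pi/2] and add up to pi; its sides are 2 sin a, 2 sin b,
   2 sin c. A convex polygon with edge lengths l_k contained in a disc of radius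
   r satisfies sum_k asin (l_k / (2 r)) <= pi. For the sum of the three
   triangles, whose edges are all the edges of the summands, and r = 2, this
   reads sum asin (sin a / 2) <= pi over the nine angles. As asin (sin a / 2) is
   at least a / 3 on [0, pi/2], with equality only at 0 and pi/2, and the nine
   angles add up to 3 pi, a disc of radius 2 containing K_1 + K_2 + K_3 forces
   every triangle to degenerate to a diameter [u_i, -u_i]. All the vectors
   +-u_1 +- u_2 +- u_3 then have norm at most 2, and as the Gram determinant of
   three vectors of the plane vanishes, the u_i span three lines at mutual
   angles pi/3 and one of these sums has norm exactly 2. *)

(** * Monotonicity of sine and cosine, and a jump estimate for the arcsine *)

Lemma cos_le_itv (R : realType) (x y : R) :
  0 <= x -> - pi <= y <= pi -> cos x <= cos y -> y <= x.
Proof.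
move=> x0 /andP[yl yu] cxy.
have [y0|/ltW y0] := leP y 0; first exact: le_trans x0.
have [xpi|/ltW] := leP x pi; last exact: le_trans.
rewrite leNgt; apply/negP => xy.
by move: cxy; rewrite leNgt ltr_cos ?xy// in_itv/= ?x0 ?y0.
Qed.

Lemma le_sin (R : realType) (x y : R) :
  - (pi / 2) <= x <= pi / 2 -> - (pi / 2) <= y <= pi / 2 ->
  (sin x <= sin y) = (x <= y).
Proof. by move=> xi yi; rewrite !leNgt ltr_sin// in_itv. Qed.

(** With [m] and [d] the half sum and half difference of the two arcsines,
    [l = sin d * cos m <= sin d]: among the strips of a given width, the one centred at the origin
    cuts the shortest arc out of the circle. *)
Lemma asin_jump (R : realType) (z w l : R) :
  -1 <= z <= 1 -> -1 <= w <= 1 -> 0 <= l -> w - z = 2 * l ->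
  2 * asin l <= asin w - asin z.
Proof.
move=> zi wi l0 wzl.
have li : -1 <= l <= 1 by lra.
have pi0 := @pi_gt0 R.
have [/andP[Al Au] sA] := asin_def wi.
have [/andP[Bl Bu] sB] := asin_def zi.
have [/andP[Ll Lu] sL] := asin_def li.
set A := asin w in Al Au sA *; set B := asin z in Bl Bu sB *.
set L := asin l in Ll Lu sL *.
pose d := (A - B) / 2; pose m := (A + B) / 2.
have Ad : A = m + d by rewrite /m /d; field.
have Bd : B = m - d by rewrite /m /d; field.
have prod : l = sin d * cos m.
  by move: wzl; rewrite -sA -sB Ad Bd sinD sinB; lra.
have m0 : 0 <= cos m by apply: cos_ge0_pihalf; rewrite /m; lra.
have m1 := cos_le1 m.
suff : L <= d by rewrite /d; lra.
have di : - (pi / 2) <= d <= pi / 2.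
  by rewrite /d; lra.
rewrite -le_sin//; last by lra.
rewrite sL.
have AB : B <= A by rewrite -le_sin ?sA ?sB; lra.
have d0 : 0 <= sin d by apply: sin_ge0_pi; rewrite /d; lra.
by nra.
Qed.

(** * Inner product and Euclidean norm in coordinates *)

(** This is [direction t] after a quarter turn: a counterclockwise polygon runs this way along an
    edge with outward normal [direction t]. *)
Definition tangent (R : realType) (t : R) : 'rV[R]_2 := vec2 (- sin t) (cos t).

Definition dot (R : realType) (x y : 'rV[R]_2) : R :=
  x 0 0 * y 0 0 + x 0 1 * y 0 1.

Lemma vec2E0 (R : realType) (a b : R) : vec2 a b 0 0 = a.
Proof. by rewrite mxE. Qed.

Lemma vec2E1 (R : realType) (a b : R) : vec2 a b 0 1 = b.
Proof. by rewrite mxE. Qed.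

Lemma vec2P (R : realType) (x y : 'rV[R]_2) :
  x 0 0 = y 0 0 -> x 0 1 = y 0 1 -> x = y.
Proof.
move=> xy0 xy1; apply/rowP => -[[|[|//]] ij].
  by rewrite (_ : Ordinal ij = 0)//; apply/val_inj.
by rewrite (_ : Ordinal ij = 1)//; apply/val_inj.
Qed.

Lemma euclidean_norm_dot (R : realType) (x : 'rV[R]_2) :
  euclidean_norm x = Num.sqrt (dot x x).
Proof.
rewrite /euclidean_norm big_ord_recl big_ord_recl big_ord0 addr0 /dot !expr2.
by rewrite (_ : lift _ _ = 1)//; exact/val_inj.
Qed.

Lemma dot_ge0 (R : realType) (x : 'rV[R]_2) : 0 <= dot x x.
Proof. by rewrite /dot -!expr2 addr_ge0// sqr_ge0. Qed.

Lemma euclidean_norm_le (R : realType) (x : 'rV[R]_2) (r : R) : 0 <= r ->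
  (euclidean_norm x <= r) = (dot x x <= r ^+ 2).
Proof.
move=> r0; rewrite euclidean_norm_dot -[in LHS](ger0_norm r0) -sqrtr_sqr.
by rewrite ler_psqrt// nnegrE ?sqr_ge0// dot_ge0.
Qed.

(** * Exit angles of rays, and convex polygons inside a disc *)

Lemma dot_tangent_itv (R : realType) (x : 'rV[R]_2) (r t : R) : 0 < r ->
  dot x x <= r ^+ 2 -> -1 <= dot x (tangent t) / r <= 1.
Proof.
move=> r0 xr; rewrite -ler_norml normrM normfV (gtr0_norm r0).
rewrite ler_pdivrMr// mul1r -(ger0_norm (ltW r0)) -ler_sqr ?nnegrE//.
rewrite !real_normK ?num_real// (le_trans _ xr)// /dot /tangent vec2E0 vec2E1.
have := cos2Dsin2 t; set c := cos t; set s := sin t => cs.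
rewrite -subr_ge0.
have -> : x 0 0 * x 0 0 + x 0 1 * x 0 1 - (x 0 0 * - s + x 0 1 * c) ^+ 2 =
  (x 0 0 * c + x 0 1 * s) ^+ 2.
  have -> : x 0 0 * x 0 0 + x 0 1 * x 0 1 =
     (x 0 0 * x 0 0 + x 0 1 * x 0 1) * (c ^+ 2 + s ^+ 2) by rewrite cs mulr1.
  by ring.
exact: sqr_ge0.
Qed.

(* The ray from x in direction t leaves the disc of radius r around the origin
   at polar angle t + asin (dot x (tangent t) / r). *)
Definition exit_angle (R : realType) (r : R) (x : 'rV[R]_2) (t : R) : R :=
  t + asin (dot x (tangent t) / r).

(** As cosine decreases on [[0, pi]], it suffices that [cos (u - t) <= p * q + z * w], with [p], [q]
    the cosines of the arcsines. For [P], [Q] the components of [x / r] along the two rays and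
    [k = 1 - |x / r|^2], Cauchy-Schwarz gives [k + P * Q <= p * q], while
    [P * Q + z * w = (1 - k) * cos (u - t)]. *)
Lemma exit_angle_le (R : realType) (r : R) (x : 'rV[R]_2) (t u : R) : 0 < r ->
  dot x x <= r ^+ 2 -> t <= u -> exit_angle r x t <= exit_angle r x u.
Proof.
move=> r0 xr tu; rewrite /exit_angle.
have ti := dot_tangent_itv t r0 xr.
have ui := dot_tangent_itv u r0 xr.
set z := _ / r in ti *; set w := _ / r in ui *.
have [/andP[Al Au] sA] := asin_def ti.
have [/andP[Bl Bu] sB] := asin_def ui.
have cA : 0 <= cos (asin z) by apply: cos_ge0_pihalf; lra.
have cB : 0 <= cos (asin w) by apply: cos_ge0_pihalf; lra.
suff : asin z - asin w <= u - t by lra.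
apply: cos_le_itv; [lra|lra|].
rewrite (cosB (asin z)) sA sB.
have zc : cos (asin z) ^+ 2 = 1 - z ^+ 2 by rewrite cos2sin2 sA.
have wc : cos (asin w) ^+ 2 = 1 - w ^+ 2 by rewrite cos2sin2 sB.
set p := cos (asin z) in cA zc *; set q := cos (asin w) in cB wc *.
pose a := x 0 0 / r; pose b := x 0 1 / r.
pose P := a * cos t + b * sin t; pose Q := a * cos u + b * sin u.
pose k := 1 - (a ^+ 2 + b ^+ 2).
have k0 : 0 <= k.
  rewrite subr_ge0 /a /b !expr_div_n -mulrDl ler_pdivrMr ?exprn_gt0// mul1r.
  by rewrite !expr2 -expr2.
have zE : z = - a * sin t + b * cos t.
  by rewrite /z /a /b /dot /tangent vec2E0 vec2E1; field; rewrite gt_eqF.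
have wE : w = - a * sin u + b * cos u.
  by rewrite /w /a /b /dot /tangent vec2E0 vec2E1; field; rewrite gt_eqF.
have ct := cos2Dsin2 t; have cu := cos2Dsin2 u.
have pE : p ^+ 2 = k + P ^+ 2.
  rewrite zc zE /k /P.
  have -> : a ^+ 2 + b ^+ 2 = (a ^+ 2 + b ^+ 2) * (cos t ^+ 2 + sin t ^+ 2).
    by rewrite ct mulr1.
  by ring.
have qE : q ^+ 2 = k + Q ^+ 2.
  rewrite wc wE /k /Q.
  have -> : a ^+ 2 + b ^+ 2 = (a ^+ 2 + b ^+ 2) * (cos u ^+ 2 + sin u ^+ 2).
    by rewrite cu mulr1.
  by ring.
have pq : k + P * Q <= p * q.
  have [neg|pos] := leP (k + P * Q) 0; first by rewrite (le_trans neg)// mulr_ge0.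
  rewrite -ler_sqr ?nnegrE ?mulr_ge0 ?(ltW pos)// exprMn pE qE.
  by have := mulr_ge0 k0 (sqr_ge0 (P - Q)); nra.
have PQ : P * Q + z * w = (1 - k) * cos (u - t).
  rewrite zE wE /P /Q /k cosB; ring.
have := cos_le1 (u - t); nra.
Qed.

Lemma dotDl (R : realType) (x y z : 'rV[R]_2) : dot (x + y) z = dot x z + dot y z.
Proof. by rewrite /dot !mxE; ring. Qed.

Lemma dotZl (R : realType) (k : R) (x y : 'rV[R]_2) : dot (k *: x) y = k * dot x y.
Proof. by rewrite /dot !mxE; ring. Qed.

Lemma dot_tangent (R : realType) (t : R) : dot (tangent t) (tangent t) = 1.
Proof. by rewrite /dot vec2E0 vec2E1 -(cos2Dsin2 t); ring. Qed.

(* A polygonal path is given by the pairs (outward normal angle, length) of its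
   edges. *)
Definition edge (R : realType) (e : R * R) : 'rV[R]_2 := e.2 *: tangent e.1.

Lemma exit_angle_edge (R : realType) (r : R) (x : 'rV[R]_2) (e : R * R) :
  0 < r -> 0 <= e.2 -> dot x x <= r ^+ 2 ->
  dot (x + edge e) (x + edge e) <= r ^+ 2 ->
  exit_angle r x e.1 + 2 * asin (e.2 / (2 * r)) <= exit_angle r (x + edge e) e.1.
Proof.
move=> r0 e0 xr xer; rewrite /exit_angle -addrA lerD2l -lerBrDl.
apply: asin_jump; [exact: dot_tangent_itv|exact: dot_tangent_itv| |].
  by rewrite divr_ge0// mulr_ge0// ltW.
by rewrite dotDl dotZl dot_tangent; field; rewrite gt_eqF.
Qed.

(** Induction on the edges: turning the ray to the next normal does not decrease the exit angle, and
    moving along the edge adds at least the arc of a chord of that length. *)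
Lemma exit_angle_path (R : realType) (r : R) (l : seq (R * R)) (x : 'rV[R]_2)
    (t u : R) :
  0 < r -> path <=%R t (map fst l) -> last t (map fst l) <= u ->
  all (fun e => 0 <= e.2) l ->
  (forall k, let y := x + \sum_(e <- take k l) edge e in dot y y <= r ^+ 2) ->
  exit_angle r x t + 2 * \sum_(e <- l) asin (e.2 / (2 * r)) <=
  exit_angle r (x + \sum_(e <- l) edge e) u.
Proof.
move=> r0; elim: l x t => [|e l IH] x t /=.
  move=> _ tu _ /(_ 0%N); rewrite big_nil addr0 !big_nil mulr0 !addr0 => xr.
  exact: exit_angle_le.
move=> /andP[te el] lu /andP[e0 l0] inr.
have x0 : dot x x <= r ^+ 2 by have := inr 0%N; rewrite /= big_nil addr0.
have x1 : dot (x + edge e) (x + edge e) <= r ^+ 2.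
  by have := inr 1%N; rewrite /= take0 big_seq1.
have := IH (x + edge e) e.1 el lu l0; rewrite !big_cons mulrDr !addrA => IHe.
apply: le_trans (IHe _) => [|k]; last first.
  by have := inr k.+1; rewrite /= big_cons addrA.
rewrite lerD2r; apply: le_trans (exit_angle_edge r0 e0 x0 x1).
by rewrite lerD2r exit_angle_le.
Qed.

(* The strips erected outwards on the edges of a convex polygon are disjoint, and
   each cuts out of the circle an arc at least as long as the one cut off by a
   chord of the length of the edge. *)
Lemma polygon_in_disc (R : realType) (r : R) (l : seq (R * R)) (x : 'rV[R]_2) :
  0 < r -> sorted <=%R (map fst l) ->
  all (fun e => (0 <= e.1 <= 2 * pi) && (0 <= e.2)) l ->
  (forall k, let y := x + \sum_(e <- take k l) edge e in dot y y <= r ^+ 2) ->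
  \sum_(e <- l) edge e = 0 ->
  \sum_(e <- l) asin (e.2 / (2 * r)) <= pi.
Proof.
move=> r0 ls lr inr l0.
have pth : path <=%R 0 (map fst l).
  case: l ls lr {inr l0} => //= e l -> /andP[/andP[/andP[-> _] _] _]; exact: erefl.
have lst : last 0 (map fst l) <= 2 * pi.
  have : all (fun y => y <= 2 * pi) (map fst l).
    by rewrite all_map; apply: sub_all lr => e /= /andP[/andP[]].
  case: (map fst l) => [_ /=|y s /= /andP[yu /allP su]].
    by rewrite mulr_ge0// pi_ge0.
  by have := mem_last y s; rewrite inE => /predU1P[->|/su].
have lp : all (fun e => 0 <= e.2) l by apply: sub_all lr => e /= /andP[].
(* The ray makes one full turn and returns to [x], where the arcsine has its initial value; so the
   exit angle grows by exactly [2 * pi]. *)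
have := exit_angle_path r0 pth lst lp inr.
rewrite l0 addr0 /exit_angle /tangent [2 * pi]mulr_natl.
have := sinD2pi (0 : R); have := cosD2pi (0 : R); rewrite /periodic !add0r => -> ->.
lra.
Qed.

(** * Chords of the unit circle and the inequality for a single angle *)

Lemma direction_edge (R : realType) (t a : R) :
  direction t + edge (t + a, 2 * sin a) = direction (t + 2 * a).
Proof.
(* [u] is the middle of the arc, where the normal of its chord points. *)
pose u := t + a.
have -> : t + 2 * a = u + a by rewrite /u; ring.
have -> : t = u - a by rewrite /u addrK.
rewrite subrK; clearbody u.
by apply: vec2P; rewrite !mxE/= ?cosB ?sinB ?cosD ?sinD; ring.
Qed.

Lemma sin_triple (R : realType) (t : R) : sin (3 * t) = 3 * sin t - 4 * sin t ^+ 3.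
Proof.
have -> : 3 * t = t + t *+ 2 by rewrite mulr2n; ring.
rewrite sinD cos_mulr2n sin_mulr2n.
transitivity (sin t * (4 * cos t ^+ 2 - 1)); first by ring.
by rewrite cos2sin2; ring.
Qed.

Lemma sin_pi6 (R : realType) : sin (pi / 6) = 1 / 2 :> R.
Proof.
have s0 : 0 <= sin (pi / 6) :> R.
  by apply: sin_ge0_pi; have := @pi_gt0 R; lra.
have := sin_triple (pi / 6 : R).
have -> : 3 * (pi / 6) = pi / 2 :> R by field.
rewrite sin_pihalf => e.
(* The equation [3 s - 4 s^3 = 1] factors in this way, and [s >= 0] leaves the double root. *)
have /eqP : (sin (pi / 6) + 1) * (2 * sin (pi / 6) - 1) ^+ 2 = 0 :> R.
  by rewrite (_ : _ * _ = 1 - (3 * sin (pi / 6) - 4 * sin (pi / 6) ^+ 3)); [lra|ring].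
rewrite mulf_eq0 expf_eq0/= => /orP[/eqP|/eqP]; lra.
Qed.

(** For [s = sin (a / 3)] the triple-angle formula gives [sin a - 2 s = s (1 - 2 s) (1 + 2 s)], and
    [s] runs from 0 to 1/2 on this range. *)
Lemma third_sin (R : realType) (a : R) : 0 <= a <= pi / 2 ->
  2 * sin (a / 3) <= sin a /\
  (sin a = 2 * sin (a / 3) -> a = 0 \/ a = pi / 2).
Proof.
move=> ai.
have aE : a = 3 * (a / 3) by field.
rewrite {2 3}aE sin_triple.
have p0 := @pi_gt0 R.
have s0 : 0 <= sin (a / 3) by apply: sin_ge0_pi; lra.
have s1 : sin (a / 3) <= 1 / 2 by rewrite -sin_pi6 le_sin; lra.
split.
  set s := sin _ in s0 s1 *; rewrite -subr_ge0.
  have -> : 3 * s - 4 * s ^+ 3 - 2 * s = s * ((1 - 2 * s) * (1 + 2 * s)) by ring.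
  by rewrite !mulr_ge0//; lra.
move=> e.
have /eqP : sin (a / 3) * ((2 * sin (a / 3) - 1) * (2 * sin (a / 3) + 1)) = 0.
  set s := sin _ in e *.
  have -> : s * ((2 * s - 1) * (2 * s + 1)) = 4 * s ^+ 3 - s by ring.
  lra.
have inj (b : R) : 0 <= b <= pi / 2 -> sin (a / 3) = sin b -> a / 3 = b.
  by move=> bi; apply: sin_inj; rewrite in_itv/=; lra.
rewrite !mulf_eq0 => /or3P[|/eqP h|/eqP h]; [move=> /eqP h; left|right|lra].
  by have := inj 0; rewrite sin0 h; lra.
by have := inj (pi / 6); rewrite sin_pi6; lra.
Qed.

Lemma asin_half_sin (R : realType) (a : R) : 0 <= a <= pi / 2 ->
  a / 3 <= asin (sin a / 2) /\
  (asin (sin a / 2) = a / 3 -> a = 0 \/ a = pi / 2).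
Proof.
move=> ai; have [h1 h2] := third_sin ai.
have p0 := @pi_gt0 R.
have s1 := sin_le1 a; have s0 := sin_geN1 a.
have si : -1 <= sin a / 2 <= 1 by lra.
have [bi bE] := asin_def si.
split; first by rewrite -le_sin ?bE; lra.
by move=> e; apply: h2; rewrite -e bE; field.
Qed.

(** * Merging the edges of several polygons *)

(** Each edge will carry the index of its polygon as a tag, by which it can be picked out of the
    merged list. *)
Lemma filter_tag (I : eqType) (T : Type) (l : I -> seq T) (i : I) (s : seq I) :
  uniq s ->
  [seq p <- flatten [seq [seq (e, j) | e <- l j] | j <- s] | p.2 == i] =
  if i \in s then [seq (e, i) | e <- l i] else [::].
Proof.
elim: s => //= j s IH /andP[js us]; rewrite filter_cat IH// inE filter_map.
rewrite (eq_filter (_ : _ =1 fun=> j == i))//.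
have [<-|ji] := eqVneq j i.
  by rewrite (negPf js) cats0 filter_predT.
by rewrite filter_pred0.
Qed.

(** Hence a prefix of the merged list consists of one prefix per polygon, and every vertex of the
    sum is a sum of vertices of the summands. *)
Lemma filter_take (T : Type) (P : pred T) (s : seq T) (k : nat) :
  exists m, [seq p <- take k s | P p] = take m [seq p <- s | P p].
Proof.
exists (size [seq p <- take k s | P p]).
have := filter_cat P (take k s) (drop k s).
by rewrite cat_take_drop => ->; rewrite take_size_cat.
Qed.

(* The edges of the sum of convex polygons are those of the summands, merged
   in the order of their normals. *)
Lemma sum_polygons_in_disc (R : realType) (n : nat) (r : R) (c : 'rV[R]_2)
    (K : 'I_n -> set 'rV[R]_2) (x : 'I_n -> 'rV[R]_2) (l : 'I_n -> seq (R * R)) :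
  0 < r -> (forall i, sorted <=%R (map fst (l i))) ->
  (forall i, all (fun e => (0 <= e.1 <= 2 * pi) && (0 <= e.2)) (l i)) ->
  (forall i k, K i (x i + \sum_(e <- take k (l i)) edge e)) ->
  (forall i, \sum_(e <- l i) edge e = 0) ->
  (forall y : 'I_n -> 'rV[R]_2, (forall i, K i (y i)) ->
     let z := \sum_i y i - c in dot z z <= r ^+ 2) ->
  \sum_i \sum_(e <- l i) asin (e.2 / (2 * r)) <= pi.
Proof.
move=> r0 ls lr lK l0 inr.
pose leT (p q : (R * R) * 'I_n) := p.1.1 <= q.1.1.
have leT_total : total leT by move=> p q; exact: le_total.
have leT_tr : transitive leT by move=> p q t; exact: le_trans.
pose s0 := flatten [seq [seq (e, j) | e <- l j] | j <- enum 'I_n].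
pose s := sort leT s0.
(* Sorting commutes with filtering, and [l i] is sorted already. *)
have sl i : [seq p <- s | p.2 == i] = [seq (e, i) | e <- l i].
  rewrite filter_sort// filter_tag ?enum_uniq// mem_enum.
  apply: (sorted_sort leT_tr); rewrite sorted_map.
  by have := ls i; rewrite sorted_map.
have sumE (V : nmodType) (f : R * R -> V) k : exists m : 'I_n -> nat,
    \sum_(p <- take k s) f p.1 = \sum_i \sum_(e <- take (m i) (l i)) f e.
  have /choice[m mE] i : exists m, [seq p <- take k s | p.2 == i] =
      [seq (e, i) | e <- take m (l i)].
    by have [m] := filter_take (fun p => p.2 == i) s k; rewrite sl -map_take; exists m.
  exists m; rewrite (partition_big snd predT)//=; apply: eq_bigr => i _.
  by rewrite -big_filter mE big_map.
have total (V : nmodType) (f : R * R -> V) :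
    \sum_(p <- s) f p.1 = \sum_i \sum_(e <- l i) f e.
  rewrite (partition_big snd predT)//=; apply: eq_bigr => i _.
  by rewrite -big_filter sl big_map.
have := @polygon_in_disc R r (map fst s) (\sum_i x i - c) r0.
rewrite !big_map (total _ (fun e => asin (e.2 / (2 * r)))); apply.
- rewrite sorted_map.
  by have := sort_sorted leT_total s0; rewrite sorted_map.
- rewrite all_map; apply/allP => -[e i] es /=.
  have : (e, i) \in [seq p <- s | p.2 == i] by rewrite mem_filter eqxx.
  by rewrite sl => /mapP[e' el [->]]; exact: (allP (lr i)).
- move=> k /=; rewrite -map_take big_map.
  have [m ->] := sumE _ (@edge R) k.
  by rewrite addrAC -big_split/=; exact: inr.
- by rewrite (total _ (@edge R)) big1.
Qed.

(** * Contact points with the unit circle and inscribed triangles *)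

(* If there were no such p, K would fit in a smaller disc, centered slightly away
   from the origin in the direction - v. *)
Lemma contact_point (R : realType) (K : set 'rV[R]_2) (v : 'rV[R]_2) :
  compact K -> K `<=` @unit_disc R -> circumradius K = 1 -> dot v v = 1 ->
  exists p, [/\ K p, dot p p = 1 & 0 <= dot p v].
Proof.
move=> cK Kdisc K1 v1.
have [_ lb] := circumradius_min cK; rewrite K1 in lb.
have Kle p : K p -> dot p p <= 1.
  by move=> /Kdisc; rewrite /unit_disc/= euclidean_norm_le// expr1n.
have [K0|/set0P Kne] := eqVneq K set0.
  suff : (1 : R) <= 0 by rewrite ler10.
  by apply: lb; split => //; exists 0; rewrite K0.
have [//|none] := pselect (exists p, [/\ K p, dot p p = 1 & 0 <= dot p v]).
(* The maximum [m] is positive on [K], since a point of [K] with [dot p v >= 0] would have norm less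
   than 1; by compactness it has a minimum [d > 0]. *)
pose f (p : 'rV[R]_2) := - dot p v; pose g (p : 'rV[R]_2) := 1 - dot p p.
pose m := f \max g.
have coord j : continuous (fun p : 'rV[R]_2 => p 0 j).
  by move=> p; exact: coord_continuous.
have dotc (h k : 'rV[R]_2 -> 'rV[R]_2) :
    (forall j, continuous (fun p => h p 0 j)) ->
    (forall j, continuous (fun p => k p 0 j)) -> continuous (fun p => dot (h p) (k p)).
  move=> hc kc p; exact: (cvgD (cvgM (hc 0 p) (kc 0 p)) (cvgM (hc 1 p) (kc 1 p))).
have vc j : continuous (fun _ : 'rV[R]_2 => v 0 j) by exact: cst_continuous.
have mc : continuous m.
  move=> p; apply: (@continuous_max _ _ f g p).
    exact: (cvgN (dotc id (fun=> v) coord vc p)).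
  exact: (@continuousB _ R^o _ (fun=> 1) (fun q => dot q q) p
    (@cst_continuous _ _ _ _) (dotc id id coord coord p)).
have [q /[!inE] Kq qmin] := compact_EVT_min Kne cK (continuous_subspaceT mc).
set d := m q in qmin.
have pv p : K p -> -1 <= dot p v <= 1.
  move=> /Kle p1; have := dot_ge0 (p + v); have := dot_ge0 (p - v).
  have -> : dot (p - v) (p - v) = dot p p - 2 * dot p v + dot v v.
    by rewrite /dot !mxE; ring.
  have -> : dot (p + v) (p + v) = dot p p + 2 * dot p v + dot v v.
    by rewrite /dot !mxE; ring.
  by rewrite v1; lra.
have d0 : 0 < d.
  rewrite /d /m /= lt_max /f /g oppr_gt0 subr_gt0.
  have [qv|//] := leP 0 (dot q v) => /=.
  rewrite lt_neqAle Kle// andbT; apply/eqP => q1; apply: none.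
  by exists q.
have d1 : d <= 1.
  rewrite /d /m /= ge_max /f /g; apply/andP; split.
    by have := pv _ Kq; lra.
  by rewrite gerBl dot_ge0.
pose h := Num.sqrt (1 - d ^+ 2 / 4).
have h2 : h ^+ 2 = 1 - d ^+ 2 / 4 by rewrite sqr_sqrtr//; nra.
have h0 : 0 <= h by exact: sqrtr_ge0.
suff : 1 <= h by nra.
(* For each [p], [dot p v <= - d] or [dot p p <= 1 - d]; as [d <= 1], a shift by [d / 4] brings the
   squared distance down to at most [1 - d ^+ 2 / 4] in both cases. *)
apply: lb; split => //; exists (- ((d / 4) *: v)).
rewrite disc_scaleE// => p Kp /=; rewrite opprK euclidean_norm_le// h2.
have -> : dot (p + (d / 4) *: v) (p + (d / 4) *: v) =
    dot p p + d / 2 * dot p v + d ^+ 2 / 16 * dot v v.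
  by rewrite /dot !mxE; field.
rewrite v1 mulr1.
have := qmin p; rewrite inE => /(_ Kp); rewrite -/d /m /= le_max /f /g.
have := pv _ Kp; have := Kle _ Kp.
by move=> ? ? /orP[?|?]; nra.
Qed.

(** The arcsine of the component along [tangent t] is the angle from [direction t] to [p]; the sign
    hypothesis makes its cosine the other component. *)
Lemma polar_near (R : realType) (p : 'rV[R]_2) (t : R) : dot p p = 1 ->
  0 <= dot p (direction t) ->
  exists u, t - pi / 2 <= u <= t + pi / 2 /\ p = direction u.
Proof.
move=> p1 pt.
have := @dot_tangent_itv R p 1 t ltr01; rewrite p1 expr1n divr1 lexx => /(_ isT) zi.
have [di sd] := asin_def zi.
set d := asin _ in di sd; exists (t + d); split; first lra.
have cd : cos d = dot p (direction t).
  rewrite /d cos_asin// -[RHS]ger0_norm// -sqrtr_sqr; congr Num.sqrt.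
  rewrite -p1 /dot /tangent /direction !vec2E0 !vec2E1.
  have := cos2Dsin2 t; set c := cos t; set s := sin t => cs.
  have -> : p 0 0 * p 0 0 + p 0 1 * p 0 1 =
    (p 0 0 * p 0 0 + p 0 1 * p 0 1) * (c ^+ 2 + s ^+ 2) by rewrite cs mulr1.
  by ring.
have ct := cos2Dsin2 t.
apply: vec2P; rewrite ?vec2E0 ?vec2E1 ?cosD ?sinD cd sd /dot /direction /tangent
  !vec2E0 !vec2E1.
- by rewrite -[LHS]mulr1 -ct; ring.
- by rewrite -[LHS]mulr1 -ct; ring.
Qed.

Lemma direction_dot (R : realType) (t : R) : dot (direction t) (direction t) = 1.
Proof. by rewrite /dot vec2E0 vec2E1 -(cos2Dsin2 t); ring. Qed.

Lemma directionD2pi (R : realType) (t : R) : direction (t + 2 * pi) = direction t.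
Proof. by rewrite /direction [2 * pi]mulr_natl cosD2pi sinD2pi. Qed.

Lemma directionDpi (R : realType) (t : R) : direction (t + pi) = - direction t.
Proof. by apply: vec2P; rewrite !mxE/= ?cosDpi ?sinDpi. Qed.

Lemma continuous_direction (R : realType) : continuous (@direction R).
Proof.
have -> : @direction R = fun t => cos t *: vec2 1 0 + sin t *: vec2 0 1.
  by apply/funext => t; apply: vec2P; rewrite !mxE/=; ring.
move=> t; apply: cvgD; apply: cvgZl; [exact: continuous_cos|exact: continuous_sin].
Qed.

(* The normals t + a, t + 2 a + b, t + 2 a + 2 b + c of the sides all lie in
   [0, 2 pi], so that the sides of several triangles can be merged. *)
Lemma contact_triangle (R : realType) (K : set 'rV[R]_2) :
  compact K -> K `<=` @unit_disc R -> circumradius K = 1 ->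
  exists t a b c : R,
    [/\ 0 <= a <= pi / 2, 0 <= b <= pi / 2, 0 <= c <= pi / 2 & a + b + c = pi] /\
    [/\ K (direction t), K (direction (t + 2 * a)),
        K (direction (t + 2 * a + 2 * b)), 0 <= t + a &
        t + 2 * a + 2 * b + c <= 2 * pi].
Proof.
move=> cK Kdisc K1.
have p0 := @pi_gt0 R.
pose C := [set t : R | K (direction t)].
have Cnear t : exists u, t - pi / 2 <= u <= t + pi / 2 /\ C u.
  have [p [Kp p1 pt]] := contact_point cK Kdisc K1 (direction_dot t).
  have [u [tu pE]] := polar_near p1 pt.
  by exists u; split; rewrite // /C/= -pE.
have Cclosed : closed C.
  apply: preimage_closed; last exact: compact_closed.
  by move=> t _; exact: continuous_direction.
have Ccompact s t : compact (`[s, t]%classic `&` C).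
  by apply: compact_closedI => //; exact: segment_compact.
have idc A : {within A, continuous (@id R)}.
  by apply: continuous_subspaceT => x; exact: cvg_id.
(* [s] lies in [[- pi, 0]]; [u] will be the last contact angle up to [s + pi] and [v] the first one
   from there on, so that the arcs before [u] and after [v] are at most half turns. *)
have [s [si Cs]] := Cnear (- (pi / 2)).
have [u /[!inE] -[/= /[!in_itv]/= ui Cu] umax] :
    exists2 u, u \in `[s, s + pi]%classic `&` C &
    forall t, t \in `[s, s + pi]%classic `&` C -> t <= u.
  apply: (compact_EVT_max (f := id)) => //.
  by exists s; split => //=; rewrite in_itv/=; lra.
have [v /[!inE] -[/= /[!in_itv]/= vi Cv] vmin] :
    exists2 v, v \in `[s + pi, s + 2 * pi]%classic `&` C &
    forall t, t \in `[s + pi, s + 2 * pi]%classic `&` C -> v <= t.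
  apply: (compact_EVT_min (f := id)) => //.
  exists (s + 2 * pi); split => /=; first by rewrite in_itv/=; lra.
  by rewrite /C/= directionD2pi.
(* In a longer gap, a contact point near the middle would lie strictly between [u] and [v]. *)
have uv : v - u <= pi.
  rewrite leNgt; apply/negP => uv.
  have [w [wi Cw]] := Cnear ((u + v) / 2).
  have [wpi|wpi] := leP w (s + pi).
    have : w <= u by apply: umax; rewrite inE; split => //=; rewrite in_itv/=; lra.
    lra.
  have : v <= w by apply: vmin; rewrite inE; split => //=; rewrite in_itv/=; lra.
  lra.
pose a := (u - s) / 2; pose b := (v - u) / 2; pose c := pi - a - b.
(* The triangle starts at the first vertex followed by a side with nonnegative normal angle; the
   sides skipped are moved to the end, one turn later. *)
have [n1|n1] := leP 0 (s + a).
  exists s, a, b, c; split; first by rewrite /c /a /b; split; lra.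
  rewrite (_ : s + 2 * a = u); last by rewrite /a; field.
  rewrite (_ : u + 2 * b = v); last by rewrite /b; field.
  by split => //; rewrite /c /a /b; lra.
have [n2|n2] := leP 0 (u + b).
  exists u, b, c, a; split; first by rewrite /c /a /b; split; lra.
  rewrite (_ : u + 2 * b = v); last by rewrite /b; field.
  rewrite (_ : v + 2 * c = s + 2 * pi); last by rewrite /c /a /b; field.
  split => //; first by rewrite directionD2pi.
  lra.
exists v, c, a, b; split; first by rewrite /c /a /b; split; lra.
rewrite (_ : v + 2 * c = s + 2 * pi); last by rewrite /c /a /b; field.
rewrite (_ : s + 2 * pi + 2 * a = u + 2 * pi); last by rewrite /c /a /b; field.
rewrite !directionD2pi; split => //; rewrite /c /a /b in n1 n2 *; lra.
Qed.

(** * Degeneration of the triangles to diameters *)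

Lemma antipodal_contact (R : realType) (K : 'I_3 -> set 'rV[R]_2) (c : 'rV[R]_2) :
  (forall i, compact (K i)) -> (forall i, K i `<=` @unit_disc R) ->
  (forall i, circumradius (K i) = 1) ->
  (forall y : 'I_3 -> 'rV[R]_2, (forall i, K i (y i)) ->
     let z := \sum_i y i - c in dot z z <= 2 ^+ 2) ->
  forall i, exists u : 'rV[R]_2, [/\ dot u u = 1, K i u & K i (- u)].
Proof.
move=> cK Kdisc K1 inr.
have p0 := @pi_gt0 R.
have /choice[q qP] i : exists q : R * R * R * R, let '(t, a, b, c) := q in
    [/\ 0 <= a <= pi / 2, 0 <= b <= pi / 2, 0 <= c <= pi / 2 & a + b + c = pi] /\
    [/\ K i (direction t), K i (direction (t + 2 * a)),
        K i (direction (t + 2 * a + 2 * b)), 0 <= t + a &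
        t + 2 * a + 2 * b + c <= 2 * pi].
  have [t [a [b [d h]]]] := contact_triangle (cK i) (@Kdisc i) (K1 i).
  by exists (t, a, b, d).
pose l i := let '(t, a, b, c) := q i in
  [:: (t + a, 2 * sin a); (t + 2 * a + b, 2 * sin b);
      (t + 2 * a + 2 * b + c, 2 * sin c)].
pose x i := direction (q i).1.1.1.
pose F (a : R) := asin (sin a / 2).
pose G i := F (q i).1.1.2 + F (q i).1.2 + F (q i).2.
have sin0pi (a : R) : 0 <= a <= pi / 2 -> 0 <= sin a.
  by move=> ai; apply: sin_ge0_pi; lra.
have edgesE (t a b d : R) : a + b + d = pi ->
    [/\ direction t + edge (t + a, 2 * sin a) = direction (t + 2 * a),
        direction (t + 2 * a) + edge (t + 2 * a + b, 2 * sin b) =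
          direction (t + 2 * a + 2 * b) &
        direction (t + 2 * a + 2 * b) + edge (t + 2 * a + 2 * b + d, 2 * sin d) =
          direction t].
  move=> abd; rewrite !direction_edge; split => //.
  by rewrite -[RHS]directionD2pi -abd; congr direction; ring.
have sumG : \sum_i G i <= pi.
  have := @sum_polygons_in_disc R 3 2 c K x l.
  rewrite (_ : \sum_i \sum_(_ <- _) _ = \sum_i G i).
    apply => //.
    - move=> i; rewrite /l; have := qP i; case: (q i) => [[[t a] b] d] /= [[? ? ? ?] _].
      by rewrite andbT; apply/andP; split; lra.
    - move=> i; rewrite /l; have := qP i.
      case: (q i) => [[[t a] b] d] /= [[? ? ? ?] [_ _ _ ? ?]].
      by rewrite !mulr_ge0 ?sin0pi// !andbT; lra.
    - move=> i k; rewrite /x /l; have := qP i.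
      case: (q i) => [[[t a] b] d] /= [[_ _ _ /(edgesE t)[e1 e2 e3]] [k1 k2 k3 _ _]].
      case: k => [|[|[|k]]] /=; rewrite ?take0 ?take_oversize ?big_cons ?big_nil
        ?addr0 ?addrA ?e1 ?e2 ?e3//.
    - move=> i; have := qP i; rewrite /l.
      case: (q i) => [[[t a] b] d] /= [[_ _ _ /(edgesE t)[e1 e2 e3]] _].
      by apply: (addrI (direction t)); rewrite !big_cons big_nil !addr0 !addrA e1 e2 e3.
  apply: eq_bigr => i _; rewrite /l /G /F.
  case: (q i) => [[[t a] b] d]; rewrite !big_cons big_nil addr0 addrA /=.
  by congr (_ + _ + _); congr asin; field.
(* Each triangle contributes at least [pi / 3], so the bound [pi] on the total forces equality for
   every angle. *)
have G0 i : 0 <= G i - pi / 3.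
  have := qP i; rewrite /G; case: (q i) => [[[t a] b] d] /= [[ai bi di abd] _].
  have [? _] := asin_half_sin ai; have [? _] := asin_half_sin bi.
  have [? _] := asin_half_sin di; rewrite /F; lra.
have sumG0 : \sum_i (G i - pi / 3) = 0.
  apply: le_anti; rewrite [0 <= _]sumr_ge0// andbT.
  by rewrite big_split/= sumr_const card_ord -mulr_natr; lra.
move=> i; have := psumr_eq0P (fun i _ => G0 i) sumG0 (i := i) isT.
have := qP i; rewrite /G; case: (q i) => [[[t a] b] d] /=.
move=> [[ai bi di abd] [k1 k2 k3 _ _]].
have [ha ea] := asin_half_sin ai; have [hb eb] := asin_half_sin bi.
have [hd ed] := asin_half_sin di; rewrite /F => e.
(* The side of a right angle is a diameter; [a] and [b] cannot both vanish, as [d <= pi / 2]. *)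
have [a0|a0] : a = 0 \/ a = pi / 2 by apply: ea; lra.
  have [b0|b0] : b = 0 \/ b = pi / 2 by apply: eb; lra.
    by exfalso; lra.
  exists (direction (t + 2 * a)); split => //; first exact: direction_dot.
  by rewrite -directionDpi (_ : pi = 2 * b)// b0; field.
exists (direction t); split => //; first exact: direction_dot.
by rewrite -directionDpi (_ : pi = 2 * a)// a0; field.
Qed.

(** * Three unit vectors whose signed sums have norm at most 2 *)

(** This is the Gram determinant of three vectors, which are linearly dependent in the plane. *)
Lemma gram_plane (R : realType) (u v w : 'rV[R]_2) :
  dot u u * dot v v * dot w w + 2 * (dot u v * dot u w * dot v w) -
    dot u u * dot v w ^+ 2 - dot v v * dot u w ^+ 2 - dot w w * dot u v ^+ 2 = 0.
Proof. by rewrite /dot; ring. Qed.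

(* The linear constraints cut out a tetrahedron, on which the Gram determinant,
   written in barycentric coordinates, has nonnegative coefficients and vanishes
   at the vertices only. *)
Lemma gram_tetrahedron (R : realType) (x y z : R) :
  1 + 2 * (x * y * z) - z ^+ 2 - y ^+ 2 - x ^+ 2 = 0 ->
  x + y + z <= 1 / 2 -> x - y - z <= 1 / 2 ->
  - x + y - z <= 1 / 2 -> - x - y + z <= 1 / 2 ->
  [/\ x = 1 / 2 \/ x = - (1 / 2), y = 1 / 2 \/ y = - (1 / 2) & z = - (2 * x * y)].
Proof.
move=> D ha hb hc hd.
pose a := 1 / 2 - (x + y + z); pose b := 1 / 2 - (x - y - z).
pose c := 1 / 2 - (- x + y - z); pose d := 1 / 2 - (- x - y + z).
have a0 : 0 <= a by rewrite subr_ge0.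
have b0 : 0 <= b by rewrite subr_ge0.
have c0 : 0 <= c by rewrite subr_ge0.
have d0 : 0 <= d by rewrite subr_ge0.
pose f (s t : R) := s * t * (s + t).
have f0 s t : 0 <= s -> 0 <= t -> 0 <= f s t by move=> *; rewrite !mulr_ge0 ?addr_ge0.
have DE : 3 * (f a b + f a c + f a d + f b c + f b d + f c d) +
    7 * (a * b * c + a * b * d + a * c * d + b * c * d) = 0.
  transitivity (8 * (1 + 2 * (x * y * z) - z ^+ 2 - y ^+ 2 - x ^+ 2)).
    by rewrite /f /a /b /c /d; field.
  by rewrite D mulr0.
have := (f0 _ _ a0 b0, f0 _ _ a0 c0, f0 _ _ a0 d0, f0 _ _ b0 c0, f0 _ _ b0 d0,
  f0 _ _ c0 d0).
have abc : 0 <= a * b * c by rewrite !mulr_ge0.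
have abd : 0 <= a * b * d by rewrite !mulr_ge0.
have acd : 0 <= a * c * d by rewrite !mulr_ge0.
have bcd : 0 <= b * c * d by rewrite !mulr_ge0.
move=> [[[[[ab ac] ad] bc] bd] cd].
have f_eq0 s t : 0 <= s -> 0 <= t -> f s t = 0 -> s = 0 \/ t = 0.
  move=> s0 t0 /eqP; rewrite !mulf_eq0 -orbA.
  by move=> /or3P[/eqP|/eqP|/eqP]; [left|right|left; lra].
(* Of any two coordinates one vanishes, so at most one of the four is nonzero and the point is a
   vertex. *)
have ab0 : a = 0 \/ b = 0 by apply: f_eq0 => //; lra.
have ac0 : a = 0 \/ c = 0 by apply: f_eq0 => //; lra.
have ad0 : a = 0 \/ d = 0 by apply: f_eq0 => //; lra.
have bc0 : b = 0 \/ c = 0 by apply: f_eq0 => //; lra.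
have bd0 : b = 0 \/ d = 0 by apply: f_eq0 => //; lra.
have cd0 : c = 0 \/ d = 0 by apply: f_eq0 => //; lra.
have xyz e1 e2 : x = e1 / 2 -> y = e2 / 2 -> z = - (e1 * e2 / 2) ->
  (e1 = 1 \/ e1 = -1) -> (e2 = 1 \/ e2 = -1) ->
  [/\ x = 1 / 2 \/ x = - (1 / 2), y = 1 / 2 \/ y = - (1 / 2) & z = - (2 * x * y)].
  move=> -> -> -> [] -> [] ->; split; lra.
have [a1|a1] := eqVneq a 0; last first.
  have bn : b = 0 by case: ab0 => // a2; rewrite a2 eqxx in a1.
  have cn : c = 0 by case: ac0 => // a2; rewrite a2 eqxx in a1.
  have dn : d = 0 by case: ad0 => // a2; rewrite a2 eqxx in a1.
  by apply: (xyz (-1) (-1)); rewrite /b /c /d in bn cn dn; lra.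
have [b1|b1] := eqVneq b 0; last first.
  have cn : c = 0 by case: bc0 => // a2; rewrite a2 eqxx in b1.
  have dn : d = 0 by case: bd0 => // a2; rewrite a2 eqxx in b1.
  by apply: (xyz (-1) 1); rewrite /a /c /d in a1 cn dn; lra.
have [c1|c1] := eqVneq c 0; last first.
  have dn : d = 0 by case: cd0 => // a2; rewrite a2 eqxx in c1.
  by apply: (xyz 1 (-1)); rewrite /a /b /d in a1 b1 dn; lra.
by apply: (xyz 1 1); rewrite /a /b /c in a1 b1 c1; lra.
Qed.

Lemma dotC (R : realType) (x y : 'rV[R]_2) : dot x y = dot y x.
Proof. by rewrite /dot; ring. Qed.

Lemma dotNl (R : realType) (x y : 'rV[R]_2) : dot (- x) y = - dot x y.
Proof. by rewrite -scaleN1r dotZl mulN1r. Qed.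

Lemma dot_direction (R : realType) (s t : R) :
  dot (direction s) (direction t) = cos (s - t).
Proof. by rewrite /dot !vec2E0 !vec2E1 cosB. Qed.

Lemma cos_pi3 (R : realType) : cos (pi / 3) = 1 / 2 :> R.
Proof. by rewrite -sin_pi6 -cosBpihalf -cosN; congr cos; field. Qed.

Lemma polar (R : realType) (p : 'rV[R]_2) : dot p p = 1 -> exists t, p = direction t.
Proof.
move=> p1; have [p0|/ltW p0] := leP 0 (dot p (direction 0)).
  by have [t [_ ->]] := polar_near p1 p0; exists t.
have p0' : 0 <= dot p (direction (0 + pi)).
  by rewrite directionDpi dotC dotNl oppr_ge0 dotC.
by have [t [_ ->]] := polar_near p1 p0'; exists t.
Qed.

Lemma direction_pi3 (R : realType) (p : 'rV[R]_2) (t : R) :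
  dot p p = 1 -> dot p (direction t) = 1 / 2 ->
  p = direction (t + pi / 3) \/ p = direction (t - pi / 3).
Proof.
move=> p1 pt; have pi0 := @pi_gt0 R.
have pt0 : 0 <= dot p (direction t) by rewrite pt; lra.
have [u [tu pE]] := polar_near p1 pt0.
move: pt; rewrite pE dot_direction -cos_pi3 => e.
have inj (x : R) : 0 <= x <= pi -> cos x = cos (pi / 3) -> x = pi / 3.
  by move=> xi; apply: cos_inj; rewrite in_itv/=; lra.
have [ut|ut] := leP t u.
  by left; congr direction; have := inj (u - t); rewrite e; lra.
right; congr direction; have := inj (t - u).
by rewrite -opprB cosN e; lra.
Qed.

Lemma sum3 (R : realType) (y : 'I_3 -> 'rV[R]_2) : \sum_i y i = y 0 + y 1 + y 2.
Proof.
rewrite !big_ord_recl big_ord0 addr0 addrA.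
by congr (y _ + y _ + y _); exact/val_inj.
Qed.

Lemma forall_I3 (P : 'I_3 -> Prop) : P 0 -> P 1 -> P 2 -> forall i, P i.
Proof.
move=> P0 P1 P2 [[|[|[|//]]] ij].
- by rewrite (_ : Ordinal ij = 0)//; exact/val_inj.
- by rewrite (_ : Ordinal ij = 1)//; exact/val_inj.
- by rewrite (_ : Ordinal ij = 2)//; exact/val_inj.
Qed.

(** Averaging the hypotheses gives [dot w w + dot c c <= r ^+ 2]. *)
Lemma antipodal_sum_le (R : realType) (r : R) (c w : 'rV[R]_2) :
  dot (w - c) (w - c) <= r ^+ 2 -> dot (- w - c) (- w - c) <= r ^+ 2 ->
  dot w w <= r ^+ 2.
Proof.
have := dot_ge0 c.
have -> : dot (w - c) (w - c) = dot w w + dot c c - 2 * dot w c.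
  by rewrite /dot !mxE; ring.
have -> : dot (- w - c) (- w - c) = dot w w + dot c c + 2 * dot w c.
  by rewrite /dot !mxE; ring.
lra.
Qed.

(** Allowing every [r] up to 2 serves both claims of the theorem: radii below 2 are excluded, and
    radius 2 yields the directions. *)
Lemma sum_in_disc (R : realType) (K : 'I_3 -> set 'rV[R]_2) (c : 'rV[R]_2) (r : R) :
  (forall i, compact (K i)) -> (forall i, K i `<=` @unit_disc R) ->
  (forall i, circumradius (K i) = 1) -> 0 <= r <= 2 ->
  (forall y : 'I_3 -> 'rV[R]_2, (forall i, K i (y i)) ->
     let z := \sum_i y i - c in dot z z <= r ^+ 2) ->
  r = 2 /\ exists (s : 'S_3) (t : R), forall i : 'I_3,
    let u := direction (t + i%:R * pi / 3) in K (s i) u /\ K (s i) (- u).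
Proof.
move=> cK Kdisc K1 /andP[r0 r2] inr.
have r4 : r ^+ 2 <= 2 ^+ 2 by rewrite ler_sqr ?nnegrE.
have /choice[u uP] : forall i, exists u : 'rV[R]_2, [/\ dot u u = 1, K i u & K i (- u)].
  apply: (antipodal_contact (c := c) cK Kdisc K1) => y Ky /=.
  by apply: le_trans r4; exact: inr.
have sum_le (w : 'I_3 -> 'rV[R]_2) : (forall i, K i (w i) /\ K i (- w i)) ->
    dot (w 0 + w 1 + w 2) (w 0 + w 1 + w 2) <= r ^+ 2.
  move=> Kw; rewrite -sum3; apply: (@antipodal_sum_le _ _ c).
    by apply: inr => i; have [] := Kw i.
  by rewrite -sumrN; apply: inr => i; have [] := Kw i.
have dotE (a b d : 'rV[R]_2) : dot a a = 1 -> dot b b = 1 -> dot d d = 1 ->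
    dot (a + b + d) (a + b + d) = 3 + 2 * (dot a b + dot a d + dot b d).
  move=> a1 b1 d1.
  transitivity (dot a a + dot b b + dot d d + 2 * (dot a b + dot a d + dot b d)).
    by rewrite /dot !mxE; ring.
  by rewrite a1 b1 d1; ring.
have NN (v : 'rV[R]_2) : dot (- v) (- v) = dot v v by rewrite dotNl dotC dotNl opprK.
have [u0 Ku0 Kn0] := uP 0; have [u1 Ku1 Kn1] := uP 1; have [u2 Ku2 Kn2] := uP 2.
pose w3 (a b d : 'rV[R]_2) (i : 'I_3) := if i == 0 then a else if i == 1 then b else d.
have triple (a b d : 'rV[R]_2) : K 0 a /\ K 0 (- a) -> K 1 b /\ K 1 (- b) ->
    K 2 d /\ K 2 (- d) -> dot (a + b + d) (a + b + d) <= r ^+ 2.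
  by move=> Ka Kb Kd; apply: (sum_le (w3 a b d)); apply: forall_I3.
have H1 := triple (u 0) (u 1) (u 2) (conj Ku0 Kn0) (conj Ku1 Kn1) (conj Ku2 Kn2).
have H2 := triple (u 0) (u 1) (- u 2) (conj Ku0 Kn0) (conj Ku1 Kn1).
have H3 := triple (u 0) (- u 1) (u 2) (conj Ku0 Kn0).
have H4 := triple (- u 0) (u 1) (u 2).
rewrite !opprK in H2 H3 H4.
have {}H2 := H2 (conj Kn2 Ku2).
have {}H3 := H3 (conj Kn1 Ku1) (conj Ku2 Kn2).
have {}H4 := H4 (conj Kn0 Ku0) (conj Ku1 Kn1) (conj Ku2 Kn2).
have dotNr (a b : 'rV[R]_2) : dot a (- b) = - dot a b by rewrite dotC dotNl dotC.
rewrite !dotE ?NN// in H1 H2 H3 H4.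
rewrite !(dotNl, dotNr) in H1 H2 H3 H4.
have := gram_plane (u 0) (u 1) (u 2); rewrite u0 u1 u2 !mul1r => D.
(* The bounds [3 + 2 (...) <= r ^+ 2 <= 4] for the four sign patterns are the faces of the
   tetrahedron. *)
have [] := gram_tetrahedron D; try lra.
move=> x y z.
(* The signs of [u 1] and [u 2] are chosen to fix the products with [u 0]; [z = - (2 * x * y)] then
   fixes the third. *)
have [v [v1 Kv v01 v12 v02]] : exists v : 'I_3 -> 'rV[R]_2,
    [/\ forall i, dot (v i) (v i) = 1, forall i, K i (v i) /\ K i (- v i),
        dot (v 1) (v 0) = 1 / 2, dot (v 2) (v 1) = 1 / 2 & dot (v 2) (v 0) = - (1 / 2)].
  pose sg (e : R) (p : 'rV[R]_2) := if 0 <= e then p else - p.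
  pose v1 := sg (dot (u 0) (u 1)) (u 1).
  pose v2 := sg (- dot (u 0) (u 2)) (u 2).
  have sgP e i : K i (u i) -> K i (- u i) -> K i (sg e (u i)) /\ K i (- sg e (u i)).
    by rewrite /sg; case: ifP => _ *; rewrite ?opprK.
  exists (w3 (u 0) v1 v2); split => /=.
  - by apply: forall_I3 => //; rewrite /w3 /= /v1 /v2 /sg; case: ifP => _; rewrite ?NN.
  - by apply: forall_I3 => //; exact: sgP.
  - rewrite /w3/= /v1 /sg; case: ifP => h; rewrite ?dotNl dotC; case: x => x; lra.
  - rewrite /w3/= /v1 /v2 /sg; case: ifP => h; case: ifP => h';
    rewrite ?(dotNl, dotNr) (dotC _ (u 1)) z; case: x => x; case: y => y;
    rewrite ?x ?y in h h' *; lra.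
  - rewrite /w3/= /v2 /sg; case: ifP => h; rewrite ?dotNl dotC; case: y => y; lra.
split.
  (* Here the squared norm of the sum is [3 + 2 (1/2 - 1/2 + 1/2) = 4]. *)
  have := sum_le v Kv; rewrite dotE//.
  by rewrite (dotC (v 0)) v01 (dotC (v 0)) v02 (dotC (v 1)) v12 => h; nra.
have [t vt] := polar (v1 0); rewrite vt in v01 v02.
have I2 : (2 : 'I_3) = 2%N :> nat by [].
(* Counterclockwise vectors keep their order; clockwise ones are reversed and start from [v 2].
   Mixed turns would give [v 2 = v 0]. *)
have [v1E|v1E] := direction_pi3 (v1 1) v01; rewrite v1E in v12.
  have [v2E|v2E] := direction_pi3 (v1 2) v12; last first.
    by move: v02; rewrite v2E addrK dot_direction subrr cos0; lra.
  exists 1%g, t => i; rewrite perm1; move: i; apply: forall_I3.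
  - by rewrite /= mul0r mul0r addr0 -vt.
  - by rewrite /= mul1r -v1E.
  - by rewrite I2 (_ : t + _ = t + pi / 3 + pi / 3) -?v2E//; field.
have [v2E|v2E] := direction_pi3 (v1 2) v12.
  by move: v02; rewrite v2E subrK dot_direction subrr cos0; lra.
exists (perm (@rev_ord_inj 3)), (t - pi / 3 - pi / 3) => i; rewrite permE; move: i.
apply: forall_I3.
- rewrite (_ : rev_ord 0 = 2); last exact/val_inj.
  by rewrite /= mul0r mul0r addr0 -v2E.
- rewrite (_ : rev_ord 1 = 1); last exact/val_inj.
  by rewrite /= mul1r subrK -v1E.
- rewrite (_ : rev_ord 2 = 0); last exact/val_inj.
  by rewrite I2 (_ : _ + _ = t) -?vt//; field.
Qed.

(** * Rotations, Minkowski sums and the conclusion *)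

Lemma rotation_direction (R : realType) (s t : R) :
  rotation s (direction t) = direction (t + s).
Proof. by apply: vec2P; rewrite !mxE/= ?cosD ?sinD; ring. Qed.

Lemma rotation_combination (R : realType) (s a b : R) (x y : 'rV[R]_2) :
  rotation s (a *: x + b *: y) = a *: rotation s x + b *: rotation s y.
Proof. by apply: vec2P; rewrite !mxE/=; ring. Qed.

Lemma rotationN (R : realType) (s : R) (x : 'rV[R]_2) :
  rotation s (- x) = - rotation s x.
Proof. by apply: vec2P; rewrite !mxE/=; ring. Qed.

Lemma convex_combination (R : realType) (A : set 'rV[R]_2) (x y : 'rV[R]_2) (l : R) :
  @convex_set R 'rV[R]_2 A -> 0 <= l <= 1 -> A x -> A y -> A ((1 - l) *: x + l *: y).
Proof.
move=> cA /andP[l0 l1] Ax Ay.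
have := cA y x (Itv01 l0 l1) (mem_set Ay) (mem_set Ax).
by rewrite inE addrC.
Qed.

Lemma compact_minkowski_sum (R : realType) (A B : set 'rV[R]_2) :
  compact A -> compact B -> compact (minkowski_sum A B).
Proof.
move=> cA cB; rewrite /minkowski_sum.
have -> : [set a + b | a in A & b in B] = (fun p => p.1 + p.2) @` (A `*` B).
  apply/seteqP; split => [_ [a Aa [b Bb <-]]|_ [[a b] [Aa Bb] <-]].
    by exists (a, b).
  by exists a => //; exists b.
apply: continuous_compact; last exact: compact_setX.
apply: continuous_subspaceT => p; apply: cvgD; [exact: cvg_fst|exact: cvg_snd].
Qed.

(** The permutation [s] renumbers the bodies: a common rotation permutes the three lines only
    cyclically and cannot reverse their order. *)
Theorem corollary1p1 (R : realType) (K : 'I_3 -> set 'rV[R]_2)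
    (K_body : forall i, convex_body (K i))
    (K_disc : forall i, K i `<=` @unit_disc R)
    (K_radius : forall i, circumradius (K i) = 1) :
  let S := minkowski_sum (minkowski_sum (K 0) (K 1)) (K 2) in
  2 <= circumradius S /\
  (circumradius S = 2 ->
   exists (s : 'S_3) (theta : R), forall i : 'I_3,
     let u := direction (i.+1%:R * pi / 3) in
     segment u (- u) `<=` rotation theta @` K (s i)).
Proof.
move=> S.
have cK i : compact (K i) by have [] := K_body i.
have cS : compact S by do 2 apply: compact_minkowski_sum => //.
have [[r0 [c Sc]] _] := circumradius_min cS.
set r := circumradius S in r0 Sc *.
have inr (y : 'I_3 -> 'rV[R]_2) : (forall i, K i (y i)) ->
    let z := \sum_i y i - c in dot z z <= r ^+ 2.
  move=> Ky /=; rewrite -euclidean_norm_le// sum3.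
  rewrite disc_scaleE// in Sc; apply: (Sc (y 0 + y 1 + y 2)).
  exists (y 0 + y 1); last by exists (y 2).
  by exists (y 0) => //; exists (y 1).
have main : r <= 2 -> r = 2 /\ exists (s : 'S_3) (t : R), forall i : 'I_3,
    let u := direction (t + i%:R * pi / 3) in K (s i) u /\ K (s i) (- u).
  by move=> r2; apply: (sum_in_disc cK K_disc K_radius _ inr); rewrite r0.
split; first by have [|/ltW//] := leP r 2 => /main[->].
move=> r2; have rle : r <= 2 by rewrite r2.
have [_ [s [t Kt]]] := main rle.
(* Indices start at 0, so this rotation takes the angle [t + i pi / 3] to [(i + 1) pi / 3]. *)
exists s, (pi / 3 - t) => i u y [l /=]; rewrite in_itv/= => l01 <-.
have [Ku Kn] := Kt i; set w := direction _ in Ku Kn.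
have uE : u = rotation (pi / 3 - t) w.
  by rewrite rotation_direction /u; congr direction; rewrite -natr1; field.
exists ((1 - l) *: w + l *: - w).
  exact: convex_combination (K_body _).1 l01 Ku Kn.
by rewrite rotation_combination rotationN uE.
Qed.
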